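(* For each $x\in E$ let $\Sigma(x)\in\mathbb{R}^{q\times q}$ be positive semi-definite, let $x\mapsto\Sigma(x)$ be locally Lipschitz (with constant $L_{\Sigma,K}$ on each compact $K\subseteq E$), and suppose $\|\Sigma(x)\|\le\frac{c_\Sigma}{2}(1+\|x\|)$ for all $x$ and some constant $c_\Sigma>0$. Let $$\mathbb{A}f(x)=\tfrac12\operatorname{Tr}\big(\Sigma(x)\Sigma^T(x)D^2f(x)\big),\qquad \widehat{\mathbb{A}}g(x,x')=\tfrac12\operatorname{Tr}\big(\widehat\Sigma^2(x,x')D^2g(x,x')\big),$$ where $$\widehat\Sigma^2(x,x')=\begin{pmatrix}\Sigma(x)\Sigma^T(x)&\Sigma(x)\Sigma^T(x')\\ \Sigma(x')\Sigma^T(x)&\Sigma(x')\Sigma^T(x')\end{pmatrix}.$$ Then $\mathbb{A}$ is compatible with $V(x)=\log(1+\frac12|x|^2)$ and with the penalization Collections 1 and 2 (see context), is linear on its domain, and admits the controlled growth coupling $\widehat{\mathbb{A}}$. Furthermore, $V$ is a Lyapunov function: $\sup_{x\in E}\mathbb{A}V(x)<\infty$.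
   Context: $E=\mathbb{R}^q$ with Euclidean distance $d$; $s_z(x)=x-z$; $d_{z_1,z_2}(x,y)=d(x-z_1,y-z_2)$; $(f_1\oplus f_2)(x_1,x_2)=f_1(x_1)+f_2(x_2)$. The operators are considered on $\mathcal{D}(\mathbb{A})=C^2(E)$ and $\mathcal{D}(\widehat{\mathbb{A}})=C^2(E^2)$. A modulus of continuity is an upper semi-continuous $\omega:[0,\infty)\to[0,\infty)$ with $\omega(0)=0$. **Penalizations.** Collection 1: $\zeta_{z,p}(x)=\langle p,x-z\rangle$, $\xi_z(x)=\frac12d^2(x,z)$. Collection 2: for fixed $R''>R'>R>0$ and a smooth $\overline\ell:[0,\infty)\to[0,\infty)$ with $\overline\ell(r)=1$ for $r<R'$ and $\overline\ell(r)=0$ for $r>R''$: $\zeta_{z,p}(x)=\overline\ell(d(x,z))\langle p,x-z\rangle$, $\xi_z(x)=(1-\overline\ell(d(x,z)))(R''+1)^2+\overline\ell(d(x,z))\frac12d^2(x,z)$. In either case $\Xi_{z_0,p,z_1}=\xi_{z_0}+\zeta_{z_0,p}+\xi_{z_1}$. **Compatibility** of $\mathbb{A}$ with $V$ and $\{\zeta_{z,p}\},\{\xi_z\}$: $V\circ s_z$ and $\Xi_{z_0,p,z_1}\circ s_z$ belong to $\mathcal{D}(\mathbb{A})$ for $z\in\overline{B_1(0)}$ and all $z_0,z_1\in E,p\in\mathbb{R}^q$, and the maps $(x,z_0,p,z_1,z)\mapsto\mathbb{A}(\Xi_{z_0,p,z_1}\circ s_z)(x)$, $(x,z)\mapsto\mathbb{A}(V\circ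 s_z)(x)$ are continuous. **Linear on domain**: $\mathbb{A}(af+g)=a\mathbb{A}f+\mathbb{A}g$ whenever $a\in\mathbb{R}$ and $f,g,af+g\in\mathcal{D}(\mathbb{A})$. **Controlled growth coupling.** $\widehat{\mathbb{A}}$ (linear on its domain) is a controlled growth coupling of $\mathbb{A}$ if: (1) $\widehat{\mathbb{A}}$ satisfies the maximum principle: for $g_1,g_2\in\mathcal{D}(\widehat{\mathbb{A}})$, if $g_1-g_2$ attains its supremum (resp. infimum) over $E^2$ at a point $w_0$ then $\widehat{\mathbb{A}}g_1(w_0)\le\widehat{\mathbb{A}}g_2(w_0)$ (resp. $\ge$); (2) $f_1\oplus f_2\in\mathcal{D}(\widehat{\mathbb{A}})$ and $\widehat{\mathbb{A}}(f_1\oplus f_2)=\mathbb{A}f_1\oplus\mathbb{A}f_2$ for $f_1,f_2\in\mathcal{D}(\mathbb{A})$; (3) $\frac\alpha2d^2_{z,z'}\in\mathcal{D}(\widehat{\mathbb{A}})$ for all $\alpha>1$, $z,z'\in E$, and for every compact $K\subseteq E$ there is a modulus of continuity $\omega_K$ such that for all $\alpha>1$, $x,x',y,y'\in K$, with $r=d(x,y)+d(y,y')+d(y',x')$: $\widehat{\mathbb{A}}\big(\frac\alpha2d^2_{x-y,x'-y'}\big)(x,x')\le\omega_K(\alpha r^2+r)$. *)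

(* Defs.v *)
From HB Require Import structures.
From mathcomp Require Import all_boot all_order all_algebra.
From mathcomp Require Import all_classical all_reals all_analysis.

Set Implicit Arguments.
Unset Strict Implicit.
Unset Printing Implicit Defensive.

Import Order.TTheory GRing.Theory Num.Theory.
Import numFieldNormedType.Exports.

Local Open Scope classical_set_scope.
Local Open Scope ring_scope.

(* R^q is 'rV[R]_q.  The library norm `|x| on matrices is the sup norm; it
   induces the usual topology, but Euclidean lengths need enorm below.
   E^2 = R^q x R^q is identified with 'rV[R]_(q + q): the point (x, x') is
   row_mx x x', and lsubmx, rsubmx are the two projections. *)

(* Euclidean norm of a row vector; Frobenius norm of a matrix. *)
Definition enorm (R : realType) (m n : nat) (M : 'M[R]_(m, n)) : R :=
  Num.sqrt (\sum_i \sum_j M i j ^+ 2).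

Definition edist (R : realType) (q : nat) (x y : 'rV[R]_q) : R := enorm (x - y).

Definition dotv (R : realType) (q : nat) (x y : 'rV[R]_q) : R :=
  \sum_i x ord0 i * y ord0 i.

Definition unit_cball (R : realType) (q : nat) : set 'rV[R]_q :=
  [set z | edist z 0 <= 1].

(* Symmetry is not required, so this also covers the convention in which
   positive semi-definite matrices are symmetric by definition. *)
Definition psd (R : realType) (q : nat) (M : 'M[R]_q) : Prop :=
  forall v : 'rV[R]_q, 0 <= dotv (v *m M) v.

Definition locally_lipschitz (R : realType) (q : nat)
    (S : 'rV[R]_q -> 'M[R]_q) : Prop :=
  forall K : set 'rV[R]_q, compact K ->
    exists L : R, forall x y, K x -> K y -> enorm (S x - S y) <= L * edist x y.

Definition basis_vec (R : realType) (n : nat) (i : 'I_n) : 'rV[R]_n :=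
  delta_mx ord0 i.

Definition partial (R : realType) (n : nat) (i : 'I_n) (f : 'rV[R]_n -> R) :
  'rV[R]_n -> R := fun x => 'D_(basis_vec R i) f x.

Definition C1 (R : realType) (n : nat) (f : 'rV[R]_n -> R) : Prop :=
  continuous f /\
  forall i : 'I_n,
    (forall x, derivable f x (basis_vec R i)) /\ continuous (partial i f).

Definition C2 (R : realType) (n : nat) (f : 'rV[R]_n -> R) : Prop :=
  C1 f /\ forall i : 'I_n, C1 (partial i f).

Definition hessian (R : realType) (n : nat) (f : 'rV[R]_n -> R)
    (x : 'rV[R]_n) : 'M[R]_n :=
  \matrix_(i, j) partial i (partial j f) x.

(* act is total; only its values on dom are meaningful. *)
Record operator (R : realType) (n : nat) := Operator {
  dom : set ('rV[R]_n -> R);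
  act : ('rV[R]_n -> R) -> ('rV[R]_n -> R) }.

Definition second_order_op (R : realType) (n : nat) (a : 'rV[R]_n -> 'M[R]_n) :
    operator R n :=
  Operator [set f | C2 f] (fun f x => 2^-1 * \tr (a x *m hessian f x)).

Definition linear_on_domain (R : realType) (n : nat) (A : operator R n) : Prop :=
  forall (a : R) (f g : 'rV[R]_n -> R),
    dom A f -> dom A g -> dom A (fun x => a * f x + g x) ->
    forall x, act A (fun y => a * f y + g y) x = a * act A f x + act A g x.

Definition shift_by (R : realType) (q : nat) (z x : 'rV[R]_q) : 'rV[R]_q := x - z.

(* zeta is indexed by (z, p) and xi by z. *)
Definition Xi (R : realType) (q : nat)
    (zeta : 'rV[R]_q -> 'rV[R]_q -> 'rV[R]_q -> R)
    (xi : 'rV[R]_q -> 'rV[R]_q -> R) (z0 p z1 x : 'rV[R]_q) : R :=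
  xi z0 x + zeta z0 p x + xi z1 x.

Definition compatible (R : realType) (q : nat) (A : operator R q)
    (V : 'rV[R]_q -> R)
    (zeta : 'rV[R]_q -> 'rV[R]_q -> 'rV[R]_q -> R)
    (xi : 'rV[R]_q -> 'rV[R]_q -> R) : Prop :=
  [/\ forall z, unit_cball z -> dom A (V \o shift_by z),
      forall z z0 p z1, unit_cball z -> dom A (Xi zeta xi z0 p z1 \o shift_by z),
      {within [set t : 'rV[R]_q * 'rV[R]_q * 'rV[R]_q * 'rV[R]_q * 'rV[R]_q |
                 unit_cball t.2],
        continuous (fun t =>
          let: (x, z0, p, z1, z) := t in
          act A (Xi zeta xi z0 p z1 \o shift_by z) x)}
    & {within [set t : 'rV[R]_q * 'rV[R]_q | unit_cball t.2],
        continuous (fun t => let: (x, z) := t in act A (V \o shift_by z) x)}].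

Definition zeta1 (R : realType) (q : nat) (z p x : 'rV[R]_q) : R :=
  dotv p (x - z).

Definition xi1 (R : realType) (q : nat) (z x : 'rV[R]_q) : R :=
  2^-1 * edist x z ^+ 2.

(* Smoothness of a function on [0, oo), in the sense of extension: only the
   values of l on [0, oo) matter. *)
Definition smooth_nonneg (R : realType) (l : R -> R) : Prop :=
  exists g : R -> R,
    (forall (n : nat) (r : R), derivable (derive1n n g) r 1) /\
    (forall r, 0 <= r -> l r = g r).

(* The three radii of the text are r0 = R, r1 = R', r2 = R''. *)
Definition cutoff (R : realType) (r0 r1 r2 : R) (l : R -> R) : Prop :=
  [/\ 0 < r0 < r1, r1 < r2, smooth_nonneg l, forall r, 0 <= r -> 0 <= l r
    & (forall r, 0 <= r < r1 -> l r = 1) /\ (forall r, r2 < r -> l r = 0)].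

Definition zeta2 (R : realType) (q : nat) (l : R -> R) (z p x : 'rV[R]_q) : R :=
  l (edist x z) * dotv p (x - z).

Definition xi2 (R : realType) (q : nat) (r2 : R) (l : R -> R)
    (z x : 'rV[R]_q) : R :=
  (1 - l (edist x z)) * (r2 + 1) ^+ 2 +
  l (edist x z) * (2^-1 * edist x z ^+ 2).

Definition modulus_of_continuity (R : realType) (w : R -> R) : Prop :=
  [/\ forall r, 0 <= r -> 0 <= w r,
      w 0 = 0
    & forall r e : R, 0 <= r -> 0 < e ->
        \forall s \near nbhs r, 0 <= s -> w s < w r + e].

Definition oplus (R : realType) (q : nat) (f1 f2 : 'rV[R]_q -> R)
    (w : 'rV[R]_(q + q)) : R :=
  f1 (lsubmx w) + f2 (rsubmx w).

Definition dshift (R : realType) (q : nat) (z1 z2 : 'rV[R]_q)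
    (w : 'rV[R]_(q + q)) : R :=
  edist (lsubmx w - z1) (rsubmx w - z2).

Definition maximum_principle (R : realType) (n : nat) (A : operator R n) : Prop :=
  forall (g1 g2 : 'rV[R]_n -> R) (w0 : 'rV[R]_n), dom A g1 -> dom A g2 ->
    ((forall w, g1 w - g2 w <= g1 w0 - g2 w0) -> act A g1 w0 <= act A g2 w0) /\
    ((forall w, g1 w0 - g2 w0 <= g1 w - g2 w) -> act A g2 w0 <= act A g1 w0).

Definition controlled_growth_coupling (R : realType) (q : nat)
    (A : operator R q) (Ahat : operator R (q + q)) : Prop :=
  [/\ linear_on_domain Ahat,
      maximum_principle Ahat,
      forall f1 f2, dom A f1 -> dom A f2 ->
        dom Ahat (oplus f1 f2) /\
        act Ahat (oplus f1 f2) = oplus (act A f1) (act A f2),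
      forall (alpha : R) (z z' : 'rV[R]_q), 1 < alpha ->
        dom Ahat (fun w => alpha / 2 * dshift z z' w ^+ 2)
    & forall K : set 'rV[R]_q, compact K ->
        exists2 omega : R -> R, modulus_of_continuity omega &
          forall (alpha : R) (x x' y y' : 'rV[R]_q), 1 < alpha ->
            K x -> K x' -> K y -> K y' ->
            let r := edist x y + edist y y' + edist y' x' in
            act Ahat (fun w => alpha / 2 * dshift (x - y) (x' - y') w ^+ 2)
              (row_mx x x') <= omega (alpha * r ^+ 2 + r)].

Definition diffusion_op (R : realType) (q : nat) (S : 'rV[R]_q -> 'M[R]_q) :
    operator R q :=
  second_order_op (fun x => S x *m (S x)^T).

Definition coupled_matrix (R : realType) (q : nat) (S : 'rV[R]_q -> 'M[R]_q)
    (x x' : 'rV[R]_q) : 'M[R]_(q + q) :=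
  block_mx (S x *m (S x)^T) (S x *m (S x')^T)
           (S x' *m (S x)^T) (S x' *m (S x')^T).

Definition coupled_diffusion_op (R : realType) (q : nat)
    (S : 'rV[R]_q -> 'M[R]_q) : operator R (q + q) :=
  second_order_op (fun w => coupled_matrix S (lsubmx w) (rsubmx w)).

Definition logV (R : realType) (q : nat) (x : 'rV[R]_q) : R :=
  ln (1 + 2^-1 * enorm x ^+ 2).

(* Main.v *)
Require Import Defs.
From mathcomp Require Import all_boot all_order all_algebra.
From mathcomp Require Import all_classical all_reals all_analysis.
From mathcomp Require Import ring lra.
Set Implicit Arguments.
Unset Strict Implicit.
Unset Printing Implicit Defensive.
Import Order.TTheory GRing.Theory Num.Theory.
Import numFieldNormedType.Exports.
Local Open Scope classical_set_scope.
Local Open Scope ring_scope.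

(** Both operators have the form f |-> tr(a D^2 f) / 2 with a Gram coefficient
    matrix a = B B^T: for the diffusion B = S(x), and for the coupling B is the
    column block matrix with blocks S(x) and S(x'), because the two copies are
    driven by the same noise. Almost everything follows from this.

    Maximum principle. tr(B B^T H) is the sum over the columns b of B of the
    quadratic forms b^T H b ([mxtrace_gram]), and for H = D^2 f each of them is
    the second derivative of f along the line in direction b, hence nonpositive
    at a maximum ([second_order_op_max]). The regularity class only speaks of
    partial derivatives, so the passage to an arbitrary direction has to be
    proved; it needs the continuity of the partials ([is_derive_basis_sum]).

    Coupling. The two projections and the difference on E^2 are linear maps
    w |-> w M, the Hessian of w |-> f (w M + c) is M (D^2 f) M^T
    ([jet2_affine]), and tr(B B^T (M H M^T)) = tr((M^T B) (M^T B)^T H)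
    ([mxtrace_gram_conj]). For the projections M^T B is S(x) or S(x'), which
    gives the marginals. For the difference M^T B = S(x) - S(x'), so that the
    coupling maps alpha/2 times the squared distance to alpha/2 times
    |S(x) - S(x')|^2 ([act_dshift]); the Lipschitz bound on a compact set then
    provides a linear modulus.

    Compatibility. The Lyapunov function and both penalizations are built from
    k(|y|^2) and h(|y|^2) <p, y> with y a translate of x and k, h twice
    continuously differentiable on [0, oo). Their Hessians are explicit and
    jointly continuous in all parameters ([compatible_radial]). For the cutoff,
    the profile is s |-> l(sqrt s), which is smooth at 0 in spite of the square
    root because l is constant near 0 ([cutoff_C2_nonneg]).

    Lyapunov bound. The Hessian of log(1 + |x|^2 / 2) is
    2 I / (2 + |x|^2) - 4 x^T x / (2 + |x|^2)^2; the second term contributes a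
    nonpositive amount, and the first one |S(x)|^2 / (2 + |x|^2), which is
    bounded by the linear growth of S ([logV_lyapunov]). *)

(** * Directional derivatives *)

Lemma is_derive_cvgP (R : realType) (V : normedModType R) (f : V -> R)
    (x v : V) (d : R) :
  h^-1 * (f (h *: v + x) - f x) @[h --> (0:R)^'] --> d <-> is_derive x v f d.
Proof.
split=> [fd|[fx <-]]; last exact: fx.
by split; [apply/cvg_ex; exists d|exact: cvg_lim fd].
Qed.

(** Reduces directional derivatives to derivatives of functions of one variable,
    where the mean value theorem and the chain rule are available. *)
Lemma is_derive_line (R : realType) (V : normedModType R) (f : V -> R)
    (x v : V) (t d : R) :
  is_derive (t *: v + x) v f d <-> is_derive t 1 (fun s => f (s *: v + x)) d.
Proof.
rewrite -!is_derive_cvgP.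
suff -> : (fun h => h^-1 * (f (h *: v + (t *: v + x)) - f (t *: v + x))) =
  (fun h => h^-1 * (f ((h *: (1 : R^o) + t) *: v + x) - f (t *: v + x))) by [].
by apply/funext => h; rewrite addrA -scalerDl [h *: 1]mulr1.
Qed.

Lemma is_derive_line0 (R : realType) (V : normedModType R) (f : V -> R)
    (x v : V) (d : R) :
  is_derive x v f d <-> is_derive (0:R) 1 (fun s => f (s *: v + x)) d.
Proof. by rewrite -is_derive_line scale0r add0r. Qed.

Lemma is_derive_dirZ (R : realType) (V : normedModType R) (f : V -> R)
    (x v : V) (c d : R) : is_derive x v f d -> is_derive x (c *: v) f (c * d).
Proof.
move=> /is_derive_line0 fd; apply/is_derive_line0.
have -> : (fun s : R => f (s *: (c *: v) + x)) =
    (fun s => f (s *: v + x)) \o (fun s : R => c * s).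
  by apply/funext => s /=; rewrite scalerA mulrC.
rewrite mulrC; apply: is_derive1_comp; first by rewrite mulr0.
have -> : (fun s : R => c * s) = c *: (id : R -> R) by [].
by apply: is_derive_eq; rewrite [_ *: _]mulr1.
Qed.

Lemma is_derive_continuous1 (R : realType) (f : R -> R) (x d : R) :
  is_derive x 1 f d -> continuous_at x f.
Proof.
by move=> [fx _]; apply/differentiable_continuous/derivable1_diffP.
Qed.

(** Additivity in the direction fails for merely directionally differentiable
    functions. It holds when the derivative D along u is continuous: by the mean
    value theorem, the increment of f from x + h v to x + h v + h u is h times a
    value of D at a point that tends to x. *)
Lemma is_derive_dirD (R : realType) (V : normedModType R) (f D : V -> R)
    (x u v : V) (d : R) :
  (forall y, is_derive y u f (D y)) -> continuous_at x D ->
  is_derive x v f d -> is_derive x (u + v) f (D x + d).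
Proof.
move=> fu Dx /is_derive_cvgP fv; apply/is_derive_cvgP.
(* Split off the increment along v, which converges to d by hypothesis. *)
suff fuv : h^-1 * (f (h *: (u + v) + x) - f (h *: v + x)) @[h --> (0:R)^'] --> D x.
  have -> : (fun h => h^-1 * (f (h *: (u + v) + x) - f x)) =
     (fun h => h^-1 * (f (h *: (u + v) + x) - f (h *: v + x)) +
               h^-1 * (f (h *: v + x) - f x)).
    by apply/funext => h; rewrite -mulrDr addrA subrK.
  exact: cvgD.
apply/cvgrPdist_lt => e e0.
have /cvgrPdist_lt/(_ e e0)/nbhs_ballP[r r0 rD] := Dx.
have uv0 : 0 < `|u| + `|v| + 1 by rewrite ltr_wpDl// addr_ge0.
near=> h.
have h0 : h != 0 by near: h; exact: nbhs_dnbhs_neq.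
have hr : `|h| < r / (`|u| + `|v| + 1).
  near: h; apply: dnbhs0_lt; exact: divr_gt0.
pose g s := f (s *: (h *: u) + (h *: v + x)).
have gd (s : R) : is_derive s 1 g (h * D (s *: (h *: u) + (h *: v + x))).
  apply/(is_derive_line f (h *: v + x) (h *: u) s); apply: is_derive_dirZ; exact: fu.
have gc : {within `[0, 1], continuous g}.
  by apply: continuous_subspaceT => s; exact: is_derive_continuous1 (gd s).
have [c] := MVT_segment ler01 (fun s _ => gd s) gc.
rewrite in_itv/= => /andP[c0 c1].
rewrite /g scale1r scale0r add0r subr0 mulr1 addrA -scalerDr => ->.
rewrite mulKf//; apply: rD.
rewrite -ball_normE /=.
have -> : x - (c *: (h *: u) + (h *: v + x)) = - (h *: (c *: u + v)).
  by rewrite scalerDr !scalerA [c * h]mulrC addrA opprD addrCA subrr addr0.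
rewrite normrN normrZ.
have : `|c *: u + v| < `|u| + `|v| + 1.
  apply: le_lt_trans (ler_normD _ _) _; rewrite ltr_pwDr// lerD2r normrZ ger0_norm//.
  by rewrite ler_piMl.
move=> /ltW cuv; move: hr; rewrite ltr_pdivlMr//.
by apply: le_lt_trans; rewrite ler_wpM2l.
Unshelve. all: by end_near. Qed.

Lemma is_derive_basis_sum (R : realType) n (f : 'rV[R]_n -> R)
    (G : 'rV[R]_n -> 'rV[R]_n) (x v : 'rV[R]_n) :
  (forall y i, is_derive y (basis_vec R i) f (G y ord0 i)) ->
  (forall i, continuous (fun y => G y ord0 i)) ->
  is_derive x v f (\sum_i v ord0 i * G x ord0 i).
Proof.
move=> fG Gc; rewrite [v in is_derive _ v](row_sum_delta v).
elim: (index_enum _) x => [|i r IH] x.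
  by rewrite !big_nil; exact: is_derive0.
rewrite !big_cons.
apply: (@is_derive_dirD _ _ f (fun y => v ord0 i * G y ord0 i) x).
- by move=> y; apply: is_derive_dirZ; exact: fG.
- by apply: continuousM; [exact: cst_continuous|exact: Gc].
Qed.

(** If the second derivative d at 0 were positive, f1 would be positive just to
    the right of 0, where f would then exceed its maximum. *)
Lemma second_derivative_le0 (R : realType) (f f1 : R -> R) (d : R) :
  (forall t : R, is_derive t 1 f (f1 t)) -> is_derive (0:R) 1 f1 d ->
  (forall t, f t <= f 0) -> d <= 0.
Proof.
move=> ff1 f1d fmax; rewrite leNgt; apply/negP => d0.
have fc t : continuous_at t f by exact: is_derive_continuous1 (ff1 t).
(* Since f1 vanishes at the maximum, f1 t has the sign of d t near 0, and
   MVT on [0, r/2] contradicts maximality. *)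
have f10 : f1 0 = 0.
  have := @derive1_at_max R f (-1) 1 0.
  have D0 : f^`()%classic 0 = f1 0 by rewrite derive1E derive_val.
  have h1 : -1 <= (1:R) by lra.
  have h0 : (0:R) \in `]-1, 1[ by rewrite in_itv/=; lra.
  move=> /(_ h1 (fun t _ => @ex_derive _ _ _ _ _ _ _ (ff1 t)) h0 (fun t _ => fmax t)).
  by move=> fd; rewrite -D0 derive1E derive_val.
move/is_derive_cvgP: f1d => /cvgrPdist_lt/(_ d d0).
rewrite f10 => /nbhs_ballP[r r0 rf1].
have fcw : {within `[0, r / 2], continuous f} by apply: continuous_subspaceT.
have r20 : 0 < r / 2 by rewrite divr_gt0.
have [c] := MVT r20 (fun s _ => ff1 s) fcw.
rewrite in_itv/= => /andP[c0 cr].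
have := fmax (r/2); rewrite -subr_le0 => /[swap] ->.
rewrite subr0 pmulr_lle0 ?divr_gt0//.
have : ball (0:R) r c by rewrite -ball_normE /= sub0r normrN gtr0_norm//; lra.
move=> /rf1/(_ (lt0r_neq0 c0)).
rewrite subr0 [c *: _]mulr1 addr0 => H.
rewrite leNgt => /negP; apply.
have : 0 < c^-1 * f1 c by move: H; rewrite ltr_norml; lra.
by rewrite pmulr_rgt0 ?invr_gt0.
Qed.

Lemma is_derive_bigsum (R : realType) (V : normedModType R) (I : Type) (r : seq I)
    (F : I -> V -> R) (dF : I -> R) (x v : V) :
  (forall i, is_derive x v (F i) (dF i)) ->
  is_derive x v (fun y => \sum_(i <- r) F i y) (\sum_(i <- r) dF i).
Proof.
move=> FdF; elim: r => [|i r IH].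
  by under eq_fun do rewrite big_nil; rewrite big_nil; exact: is_derive_cst.
by under eq_fun do rewrite big_cons; rewrite big_cons; exact: is_deriveD.
Qed.

Lemma is_derive_mul (R : realType) (V : normedModType R) (f g : V -> R)
    (df dg : R) (x v : V) :
  is_derive x v f df -> is_derive x v g dg ->
  is_derive x v (fun y => f y * g y) (f x * dg + g x * df).
Proof. exact: is_deriveM. Qed.

Lemma is_derive_add (R : realType) (V : normedModType R) (f g : V -> R)
    (df dg : R) (x v : V) :
  is_derive x v f df -> is_derive x v g dg ->
  is_derive x v (fun y => f y + g y) (df + dg).
Proof. exact: is_deriveD. Qed.

Lemma is_derive_cmul (R : realType) (V : normedModType R) (c : R) (f : V -> R)
    (df : R) (x v : V) :
  is_derive x v f df -> is_derive x v (fun y => c * f y) (c * df).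
Proof. exact: is_deriveZ. Qed.

Lemma is_derive_comp_dir (R : realType) (V : normedModType R) (k : R -> R)
    (f : V -> R) (x v : V) (a b : R) : is_derive (f x) 1 k a -> is_derive x v f b ->
  is_derive x v (fun y => k (f y)) (a * b).
Proof.
move=> ka /is_derive_line0 fb; apply/is_derive_line0.
apply: (@is_derive1_comp R k (fun s : R => f (s *: v + x))) => //.
by rewrite scale0r add0r.
Qed.

(** * Continuity of matrix-valued maps *)

Lemma continuous_atP (R : realType) (T : topologicalType) (f : T -> R) (x : T) :
  continuous_at x f <->
  forall e : R, 0 < e -> \forall y \near x, `|f x - f y| < e.
Proof. by split=> [/cvgrPdist_lt|fx]; last apply/cvgrPdist_lt. Qed.

Lemma continuous_cmul (R : realType) (T : topologicalType) (c : R) (f : T -> R)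
    (x : T) : continuous_at x f -> continuous_at x (fun y => c * f y).
Proof. by move=> fx; apply: continuousM fx; exact: cst_continuous. Qed.

Lemma continuous_at_comp (T U W : topologicalType) (f : T -> U) (g : U -> W)
    (x : T) : continuous_at x f -> continuous_at (f x) g ->
  continuous_at x (fun y => g (f y)).
Proof. exact: continuous_comp. Qed.

Section continuous_matrix.
Variables (R : realType) (T : topologicalType).

Lemma continuous_entries m n (F : T -> 'M[R]_(m, n)) (x : T) :
  (forall i j, continuous_at x (fun y => F y i j)) ->
  continuous_at x F.
Proof.
move=> Fx; apply/cvg_ballP => e e0.
suff : \forall y \near x, forall i, forall j, ball (F x i j) e (F y i j).
  by apply: filterS => y Fy; split.
apply: (@filter_forall _ _ _ (nbhs x)) => i.
apply: (@filter_forall _ _ _ (nbhs x)) => j.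
by have /cvg_ballP/(_ e e0) := Fx i j.
Qed.

Lemma continuous_entry m n (F : T -> 'M[R]_(m, n)) (x : T) i j :
  continuous_at x F -> continuous_at x (fun y => F y i j).
Proof.
move=> Fx; apply: (@continuous_comp _ _ _ F (fun M : 'M[R]_(m, n) => M i j)) => //.
exact: coord_continuous.
Qed.

Lemma continuous_bigsum (I : Type) (r : seq I) (F : I -> T -> R) (x : T) :
  (forall i, continuous_at x (F i)) ->
  continuous_at x (fun y => \sum_(i <- r) F i y).
Proof.
move=> Fx; elim: r => [|i r IH].
  by under eq_fun do rewrite big_nil; exact: cst_continuous.
by under eq_fun do rewrite big_cons; apply: continuousD; [exact: Fx|exact: IH].
Qed.

Lemma continuous_mulmx m n p (F : T -> 'M[R]_(m, n)) (G : T -> 'M[R]_(n, p))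
    (x : T) : continuous_at x F -> continuous_at x G ->
  continuous_at x (fun y => F y *m G y).
Proof.
move=> Fx Gx; apply: continuous_entries => i j; under eq_fun do rewrite mxE.
by apply: continuous_bigsum => k; apply: continuousM; exact: continuous_entry.
Qed.

Lemma continuous_trmx m n (F : T -> 'M[R]_(m, n)) (x : T) :
  continuous_at x F -> continuous_at x (fun y => (F y)^T).
Proof.
move=> Fx; apply: continuous_entries => i j; under eq_fun do rewrite mxE.
exact: continuous_entry.
Qed.

Lemma continuous_mxtrace n (F : T -> 'M[R]_n) (x : T) :
  continuous_at x F -> continuous_at x (fun y => \tr (F y)).
Proof.
by move=> Fx; apply: continuous_bigsum => k; exact: continuous_entry.
Qed.

Lemma continuous_dotv n (F G : T -> 'rV[R]_n) (x : T) :
  continuous_at x F -> continuous_at x G ->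
  continuous_at x (fun y => dotv (F y) (G y)).
Proof.
move=> Fx Gx.
by apply: continuous_bigsum => k; apply: continuousM; exact: continuous_entry.
Qed.

Lemma continuous_scalemx m n (f : T -> R) (F : T -> 'M[R]_(m, n)) (x : T) :
  continuous_at x f -> continuous_at x F ->
  continuous_at x (fun y => f y *: F y).
Proof.
move=> fx Fx; apply: continuous_entries => i j; under eq_fun do rewrite mxE.
by apply: continuousM => //; exact: continuous_entry.
Qed.

Lemma continuous_addmx m n (F G : T -> 'M[R]_(m, n)) (x : T) :
  continuous_at x F -> continuous_at x G ->
  continuous_at x (fun y => F y + G y).
Proof. exact: continuousD. Qed.

End continuous_matrix.

(** * Gradients and Hessians of twice continuously differentiable functions *)

(** A certificate that f is twice continuously differentiable, carrying the
    gradient G and the Hessian H explicitly, so that they can be computed along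
    the construction of f. Entry (i, j) of H is the derivative in direction i of
    the j-th partial derivative, as in [hessian]. *)
Definition jet2 (R : realType) n (f : 'rV[R]_n -> R)
    (G : 'rV[R]_n -> 'rV[R]_n) (H : 'rV[R]_n -> 'M[R]_n) : Prop :=
  [/\ continuous f, continuous G, continuous H,
    forall x i, is_derive x (basis_vec R i) f (G x ord0 i) &
    forall x i j, is_derive x (basis_vec R i) (fun y => G y ord0 j) (H x i j)].

Section jet2_theory.
Variables (R : realType) (n : nat).
Implicit Types (f g : 'rV[R]_n -> R) (G : 'rV[R]_n -> 'rV[R]_n)
  (H : 'rV[R]_n -> 'M[R]_n).

Lemma jet2_partial f G H i : jet2 f G H -> partial i f = fun x => G x ord0 i.
Proof. by move=> [_ _ _ fG _]; apply/funext => x; exact: derive_val. Qed.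

Lemma jet2_hessian f G H : jet2 f G H -> hessian f = H.
Proof.
move=> J; apply/funext => x; apply/matrixP => i j.
rewrite mxE (jet2_partial j J); have [_ _ _ _ GH] := J; exact: derive_val.
Qed.

Lemma jet2_C2 f G H : jet2 f G H -> C2 f.
Proof.
move=> J; have [fc Gc Hc fG GH] := J.
split.
  split=> // i; split=> [x|]; first exact: ex_derive.
  by rewrite (jet2_partial i J) => x; apply: continuous_entry; exact: Gc.
move=> i; rewrite (jet2_partial i J); split.
  by move=> x; apply: continuous_entry; exact: Gc.
move=> j; split=> [x|]; first exact: ex_derive.
have -> : partial j (fun x => G x ord0 i) = fun x => H x j i.
  by apply/funext => x; exact: derive_val.
by move=> x; apply: continuous_entry; exact: Hc.
Qed.

Lemma C2_jet2 f : C2 f -> jet2 f (fun x => \row_i partial i f x) (hessian f).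
Proof.
move=> [[fc fd] fdd]; split => //.
- move=> x; apply: continuous_entries => i j; under eq_fun do rewrite mxE.
  exact: (fd j).2.
- move=> x; apply: continuous_entries => i j; under eq_fun do rewrite mxE.
  exact: ((fdd j).2 i).2.
- by move=> x i; rewrite mxE; apply: derivableP; exact: (fd i).1.
- move=> x i j; under eq_fun do rewrite mxE.
  by rewrite mxE; apply: derivableP; exact: ((fdd j).2 i).1.
Qed.

Lemma jet2_dir f G H x v : jet2 f G H -> is_derive x v f (dotv v (G x)).
Proof.
move=> [_ Gc _ fG _]; apply: is_derive_basis_sum => // i y.
by apply: continuous_entry; exact: Gc.
Qed.

Lemma jet2_dir2 f G H x v j : jet2 f G H ->
  is_derive x v (fun y => G y ord0 j) (\sum_i v ord0 i * H x i j).
Proof.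
move=> [_ _ Hc _ GH].
have := @is_derive_basis_sum R n (fun y => G y ord0 j)
  (fun y => \row_i H y i j) x v.
under eq_bigr do rewrite mxE; apply.
- by move=> y i; rewrite mxE; exact: GH.
- move=> i y; under eq_fun do rewrite mxE.
  by apply: continuous_entry; exact: Hc.
Qed.

(** With [jet2_dir], the second derivative of f in the direction v. *)
Lemma jet2_secondvar f G H x v : jet2 f G H ->
  is_derive x v (fun y => dotv v (G y)) ((v *m H x *m v^T) ord0 ord0).
Proof.
move=> J; rewrite mxE.
have -> : \sum_j (v *m H x) ord0 j * v^T j ord0 =
   \sum_j v ord0 j * \sum_i v ord0 i * H x i j.
  by apply: eq_bigr => j _; rewrite !mxE mulrC.
apply: is_derive_bigsum => j; apply: is_derive_cmul; exact: jet2_dir2 J.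
Qed.

Lemma jet2_cst (c : R) : @jet2 R n (fun _ => c) (fun _ => 0) (fun _ => 0).
Proof.
split; do ?[by move=> x; exact: cst_continuous].
- by move=> x i; rewrite mxE; exact: is_derive_cst.
- by move=> x i j; under eq_fun do rewrite mxE; rewrite mxE; exact: is_derive_cst.
Qed.

Lemma jet2D f G H f' G' H' : jet2 f G H -> jet2 f' G' H' ->
  jet2 (fun x => f x + f' x) (fun x => G x + G' x) (fun x => H x + H' x).
Proof.
move=> [fc Gc Hc fG GH] [fc' Gc' Hc' fG' GH']; split.
- by move=> x; apply: continuousD; [exact: fc|exact: fc'].
- by move=> x; apply: continuousD; [exact: Gc|exact: Gc'].
- by move=> x; apply: continuousD; [exact: Hc|exact: Hc'].
- by move=> x i; rewrite mxE; exact: is_derive_add.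
- by move=> x i j; under eq_fun do rewrite mxE; rewrite mxE; exact: is_derive_add.
Qed.

Lemma jet2M f G H f' G' H' : jet2 f G H -> jet2 f' G' H' ->
  jet2 (fun x => f x * f' x) (fun x => f x *: G' x + f' x *: G x)
    (fun x => f x *: H' x + (G x)^T *m G' x + (G' x)^T *m G x + f' x *: H x).
Proof.
move=> [fc Gc Hc fG GH] [fc' Gc' Hc' fG' GH']; split.
- by move=> x; apply: continuousM; [exact: fc|exact: fc'].
- by move=> x; apply: continuous_addmx; apply: continuous_scalemx;
    do ?[exact: fc|exact: fc'|exact: Gc|exact: Gc'].
- move=> x; apply: continuous_addmx; last exact: (continuous_scalemx (fc' x) (Hc x)).
  apply: continuous_addmx;
    last exact: (continuous_mulmx (continuous_trmx (Gc' x)) (Gc x)).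
  apply: continuous_addmx;
    last exact: (continuous_mulmx (continuous_trmx (Gc x)) (Gc' x)).
  exact: (continuous_scalemx (fc x) (Hc' x)).
- by move=> x i; rewrite !mxE; exact: is_derive_mul.
- move=> x i j; under eq_fun do rewrite !mxE.
  have -> : (f x *: H' x + (G x)^T *m G' x + (G' x)^T *m G x + f' x *: H x) i j =
    (f x * H' x i j + G' x ord0 j * G x ord0 i) +
    (f' x * H x i j + G x ord0 j * G' x ord0 i).
    by rewrite !mxE !big_ord1 !mxE; ring.
  by apply: is_derive_add; apply: is_derive_mul.
Qed.

Lemma jet2Z (c : R) f G H : jet2 f G H ->
  jet2 (fun x => c * f x) (fun x => c *: G x) (fun x => c *: H x).
Proof.
move=> J; have := jet2M (jet2_cst c) J.
rewrite (_ : (fun x => c *: G x + _) = fun x => c *: G x); last first.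
  by apply/funext => x; rewrite scaler0 addr0.
rewrite (_ : (fun x => c *: H x + _ + _ + _) = fun x => c *: H x) //.
by apply/funext => x; rewrite scaler0 addr0 trmx0 mul0mx mulmx0 !addr0.
Qed.

Lemma jet2_comp (k k1 k2 : R -> R) f G H : jet2 f G H ->
  (forall x, [/\ is_derive (f x) 1 k (k1 (f x)),
     is_derive (f x) 1 k1 (k2 (f x)) & continuous_at (f x) k2]) ->
  jet2 (fun x => k (f x)) (fun x => k1 (f x) *: G x)
   (fun x => k2 (f x) *: ((G x)^T *m G x) + k1 (f x) *: H x).
Proof.
move=> [fc Gc Hc fG GH] kf.
have kc x : continuous_at x (fun y => k (f y)).
  by have [/is_derive_continuous1 kfx _ _] := kf x; exact: continuous_at_comp (fc x) kfx.
have k1c x : continuous_at x (fun y => k1 (f y)).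
  by have [_ /is_derive_continuous1 kfx _] := kf x; exact: continuous_at_comp (fc x) kfx.
have k2c x : continuous_at x (fun y => k2 (f y)).
  by have [_ _ kfx] := kf x; exact: continuous_at_comp (fc x) kfx.
split.
- exact: kc.
- by move=> x; apply: continuous_scalemx; [exact: k1c|exact: Gc].
- move=> x; apply: continuous_addmx; last exact: (continuous_scalemx (k1c x) (Hc x)).
  apply: continuous_scalemx; first exact: k2c.
  exact: (continuous_mulmx (continuous_trmx (Gc x)) (Gc x)).
- by move=> x i; rewrite mxE; have [kx _ _] := kf x; exact: is_derive_comp_dir.
- move=> x i j; under eq_fun do rewrite !mxE.
  have -> : (k2 (f x) *: ((G x)^T *m G x) + k1 (f x) *: H x) i j =
    k1 (f x) * H x i j + G x ord0 j * (k2 (f x) * G x ord0 i).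
    by rewrite !mxE !big_ord1 !mxE; ring.
  by apply: is_derive_mul => //; have [_ kx _] := kf x; exact: is_derive_comp_dir.
Qed.

Lemma jet2_sum (I : Type) (r : seq I) (f : I -> 'rV[R]_n -> R)
    (G : I -> 'rV[R]_n -> 'rV[R]_n) (H : I -> 'rV[R]_n -> 'M[R]_n) :
  (forall i, jet2 (f i) (G i) (H i)) ->
  jet2 (fun x => \sum_(i <- r) f i x) (fun x => \sum_(i <- r) G i x)
    (fun x => \sum_(i <- r) H i x).
Proof.
move=> J; elim: r => [|i r IH].
  have E (V : zmodType) (F : I -> 'rV[R]_n -> V) :
      (fun x => \sum_(i <- [::]) F i x) = (fun=> 0).
    by apply/funext => x; rewrite big_nil.
  by rewrite !E; exact: jet2_cst.
have E (V : zmodType) (F : I -> 'rV[R]_n -> V) :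
    (fun x => \sum_(j <- i :: r) F j x) = (fun x => F i x + \sum_(j <- r) F j x).
  by apply/funext => x; rewrite big_cons.
by rewrite !E; exact: jet2D.
Qed.

Lemma jet2_coord (i : 'I_n) :
  @jet2 R n (fun x => x ord0 i) (fun _ => delta_mx ord0 i) (fun _ => 0).
Proof.
split; do ?[by move=> x; exact: cst_continuous].
- exact: coord_continuous.
- move=> x j; apply/is_derive_line0; rewrite mxE eqxx eq_sym/=.
  have -> : (fun s : R => (s *: basis_vec R j + x) ord0 i) =
    fun s => (i == j)%:R * s + x ord0 i.
    by apply/funext => s; rewrite !mxE eqxx/= mulrC.
  rewrite -[d in is_derive _ _ _ d]addr0.
  apply: is_derive_add.
  by rewrite -[d in is_derive _ _ _ d]mulr1; apply: is_derive_cmul; exact: is_derive_id.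
- by move=> x j k; rewrite [X in is_derive _ _ _ X]mxE; exact: is_derive_cst.
Qed.

Lemma jet2_dotv (p : 'rV[R]_n) : jet2 (dotv p) (fun _ => p) (fun _ => 0).
Proof.
have := @jet2_sum _ (index_enum 'I_n) _ _ _ (fun i => jet2Z (p ord0 i) (jet2_coord i)).
rewrite (_ : (fun x => \sum_i _ *: delta_mx _ _) = fun=> p); last first.
  by apply/funext => x; rewrite -row_sum_delta.
rewrite (_ : (fun x => \sum_i _ *: 0) = fun=> 0) //.
by apply/funext => x; under eq_bigr do rewrite scaler0; rewrite big1.
Qed.

Lemma jet2_sqr : @jet2 R n (fun x => dotv x x) (fun x => 2 *: x) (fun _ => 2%:M).
Proof.
have := @jet2_sum _ (index_enum 'I_n) _ _ _ (fun i => jet2M (jet2_coord i) (jet2_coord i)).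
rewrite (_ : (fun x => \sum_i (_ *: delta_mx _ _ + _)) = fun x => 2 *: x); last first.
  apply/funext => x; rewrite big_split/= -row_sum_delta.
  by rewrite -[2]/(1 + 1) scalerDl scale1r.
rewrite (_ : (fun x => \sum_i _ ) = fun=> 2%:M) //.
apply/funext => x; apply/matrixP => i j; rewrite summxE !mxE.
under eq_bigr do rewrite !mxE !big_ord1 !mxE !eqxx /= !mulr0 addr0 add0r.
rewrite (bigD1 i)//= eqxx big1 ?addr0; last first.
  by move=> k ki; rewrite eq_sym (negbTE ki) mul0r addr0.
by rewrite eq_sym; case: eqP => _; rewrite ?mulr1 ?mulr0 ?addr0// mulr1n.
Qed.

End jet2_theory.

(** Chain rule for w |-> w M + c: its derivative along basis vector i is row i
    of M, hence the conjugation of the Hessian by M. *)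
Lemma jet2_affine (R : realType) m n (M : 'M[R]_(m, n)) (c : 'rV[R]_n)
    (f : 'rV[R]_n -> R) G H : jet2 f G H ->
  jet2 (fun x => f (x *m M + c)) (fun x => G (x *m M + c) *m M^T)
    (fun x => M *m H (x *m M + c) *m M^T).
Proof.
move=> J; have [fc Gc Hc _ _] := J.
have Mc (x : 'rV[R]_m) : continuous_at x (fun y => y *m M + c).
  apply: continuous_addmx; last exact: cst_continuous.
  by apply: continuous_mulmx; [exact: cvg_id|exact: cst_continuous].
have dM (g : 'rV[R]_n -> R) (x v : 'rV[R]_m) d :
    is_derive (x *m M + c) (v *m M) g d ->
    is_derive x v (fun y => g (y *m M + c)) d.
  move=> /is_derive_line0 gd; apply/is_derive_line0.
  rewrite (_ : (fun s => _) = (fun s : R => g (s *: (v *m M) + (x *m M + c)))) //.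
  by apply/funext => s; rewrite mulmxDl -scalemxAl addrA.
have basisM i : basis_vec R i *m M = row i M by rewrite rowE.
split.
- by move=> x; exact: (continuous_at_comp (Mc x) (fc _)).
- move=> x; apply: continuous_mulmx; last exact: cst_continuous.
  exact: (continuous_at_comp (Mc x) (Gc _)).
- move=> x; apply: continuous_mulmx; last exact: cst_continuous.
  apply: continuous_mulmx; first exact: cst_continuous.
  exact: (continuous_at_comp (Mc x) (Hc _)).
- move=> x i; apply: dM; apply: is_derive_eq; first exact: jet2_dir J.
  by rewrite basisM mxE; apply: eq_bigr => j _; rewrite !mxE mulrC.
- move=> x i j; apply: (dM (fun y => (G y *m M^T) ord0 j)).
  under eq_fun do rewrite mxE; rewrite mxE.
  apply: is_derive_bigsum => k.
  have -> : (fun y => G y ord0 k * M^T k j) = fun y => M^T k j * G y ord0 k.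
    by apply/funext => y; rewrite mulrC.
  rewrite mulrC; apply: is_derive_cmul; apply: is_derive_eq; first exact: jet2_dir2 J.
  by rewrite basisM mxE; apply: eq_bigr => l _; rewrite mxE.
Qed.

Lemma jet2_shift (R : realType) n (c : 'rV[R]_n) (f : 'rV[R]_n -> R) G H :
  jet2 f G H ->
  jet2 (fun x => f (x - c)) (fun x => G (x - c)) (fun x => H (x - c)).
Proof.
move=> /(jet2_affine 1%:M (- c)).
rewrite (_ : (fun x => f _) = fun x => f (x - c)); last first.
  by apply/funext => x; rewrite mulmx1.
rewrite (_ : (fun x => G _ *m _) = fun x => G (x - c)); last first.
  by apply/funext => x; rewrite trmx1 !mulmx1.
rewrite (_ : (fun x => _ *m H _ *m _) = fun x => H (x - c)) //.
by apply/funext => x; rewrite trmx1 !mulmx1 mul1mx.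
Qed.

(** * Second-order operators and the coupling *)

Lemma mxtrace_mul_tr (R : realType) m n (X : 'M[R]_(m, n)) :
  \tr (X *m X^T) = enorm X ^+ 2.
Proof.
rewrite /enorm sqr_sqrtr; last by do 2!apply: sumr_ge0 => ? _; exact: sqr_ge0.
by apply: eq_bigr => i _; rewrite mxE; apply: eq_bigr => j _; rewrite mxE expr2.
Qed.

Lemma enorm_ge0 (R : realType) m n (X : 'M[R]_(m, n)) : 0 <= enorm X.
Proof. exact: sqrtr_ge0. Qed.

Lemma dotv_ge0 (R : realType) n (u : 'rV[R]_n) : 0 <= dotv u u.
Proof. by apply: sumr_ge0 => i _; rewrite -expr2 sqr_ge0. Qed.

Lemma enorm_row (R : realType) n (u : 'rV[R]_n) : enorm u = Num.sqrt (dotv u u).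
Proof. by rewrite /enorm big_ord1. Qed.

Lemma enorm_row_sqr (R : realType) n (u : 'rV[R]_n) : enorm u ^+ 2 = dotv u u.
Proof. by rewrite enorm_row sqr_sqrtr// dotv_ge0. Qed.

Section second_order.
Variables (R : realType) (n : nat).

Lemma act_jet2 (a : 'rV[R]_n -> 'M[R]_n) f G H x : jet2 f G H ->
  act (second_order_op a) f x = 2^-1 * \tr (a x *m H x).
Proof. by move=> J; rewrite /= (jet2_hessian J). Qed.

Lemma second_order_op_linear (a : 'rV[R]_n -> 'M[R]_n) :
  linear_on_domain (second_order_op a).
Proof.
move=> c f g /C2_jet2 Jf /C2_jet2 Jg _ x.
rewrite (act_jet2 _ _ (jet2D (jet2Z c Jf) Jg)) !(act_jet2 _ _ Jf, act_jet2 _ _ Jg).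
by rewrite mulmxDr -scalemxAr mxtraceD mxtraceZ mulrDr mulrCA.
Qed.

Lemma jet2_max_le0 (f : 'rV[R]_n -> R) G H (w v : 'rV[R]_n) : jet2 f G H ->
  (forall y, f y <= f w) -> (v *m H w *m v^T) ord0 ord0 <= 0.
Proof.
move=> J fmax; apply: (@second_derivative_le0 _ (fun t => f (t *: v + w))
  (fun t => dotv v (G (t *: v + w)))).
- by move=> t; apply/(is_derive_line f w v t); exact: jet2_dir J.
- by apply/(is_derive_line0 (fun y => dotv v (G y)) w v); exact: jet2_secondvar J.
- by move=> t; rewrite scale0r add0r.
Qed.

(** The trace against a Gram matrix only sees the quadratic form of H on the
    columns of B. *)
Lemma mxtrace_gram m (B : 'M[R]_(n, m)) (H : 'M[R]_n) :
  \tr (B *m B^T *m H) =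
  \sum_k (row k B^T *m H *m (row k B^T)^T) ord0 ord0.
Proof.
rewrite -mulmxA mxtrace_mulC; apply: eq_bigr => k _.
by rewrite -row_mul !mxE; apply: eq_bigr => j _; rewrite !mxE.
Qed.

(** At a maximum of g1 - g2 every second directional derivative is nonpositive,
    in particular those along the columns of B. *)
Lemma second_order_op_max (a : 'rV[R]_n -> 'M[R]_n) :
  (forall w, exists m (B : 'M[R]_(n, m)), a w = B *m B^T) ->
  maximum_principle (second_order_op a).
Proof.
move=> agram.
have half g1 g2 w0 : C2 g1 -> C2 g2 ->
    (forall w, g1 w - g2 w <= g1 w0 - g2 w0) ->
    act (second_order_op a) g1 w0 <= act (second_order_op a) g2 w0.
  move=> /C2_jet2 J1 /C2_jet2 J2 gmax.
  have J := jet2D J1 (jet2Z (-1) J2).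
  have {}gmax w : g1 w + -1 * g2 w <= g1 w0 + -1 * g2 w0 by rewrite !mulN1r.
  have {J gmax}Hle v := jet2_max_le0 v J gmax.
  have [m [B aB]] := agram w0.
  rewrite (act_jet2 a w0 J1) (act_jet2 a w0 J2).
  rewrite ler_pM2l; last by rewrite invr_gt0.
  rewrite -subr_le0.
  have -> : \tr (a w0 *m hessian g1 w0) - \tr (a w0 *m hessian g2 w0) =
      \tr (a w0 *m (hessian g1 w0 + -1 *: hessian g2 w0)).
    by rewrite mulmxDr -scalemxAr mxtraceD mxtraceZ mulN1r.
  by rewrite aB mxtrace_gram; apply: sumr_le0 => k _; exact: Hle.
move=> g1 g2 w0 Cg1 Cg2; split=> [|gmin]; first exact: (half g1 g2 w0 Cg1 Cg2).
apply: (half g2 g1 w0 Cg2 Cg1) => w.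
by rewrite -opprB -[leRHS]opprB lerN2.
Qed.

(** Transfers the change of variables from the Hessian to the noise
    coefficients: B is replaced by M^T B. *)
Lemma mxtrace_gram_conj m p (B : 'M[R]_(n, m)) (P : 'M[R]_(n, p)) (H : 'M[R]_p) :
  \tr (B *m B^T *m (P *m H *m P^T)) =
  \tr ((P^T *m B) *m (P^T *m B)^T *m H).
Proof.
by rewrite [B *m B^T *m _]mulmxA mxtrace_mulC trmx_mul trmxK !mulmxA.
Qed.

End second_order.

Section coupling.
Variables (R : realType) (q : nat) (S : 'rV[R]_q -> 'M[R]_q).

(** Both copies are driven by the same noise, so the coupled covariance has
    rank at most q rather than 2 q. *)
Lemma coupled_matrix_gram x x' :
  coupled_matrix S x x' = col_mx (S x) (S x') *m (col_mx (S x) (S x'))^T.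
Proof. by rewrite tr_col_mx mul_col_row. Qed.

Definition lproj_mx : 'M[R]_(q + q, q) := col_mx 1%:M 0.
Definition rproj_mx : 'M[R]_(q + q, q) := col_mx 0 1%:M.
Definition diff_mx : 'M[R]_(q + q, q) := col_mx 1%:M (- 1%:M).

Lemma oplus_jet2 f1 G1 H1 f2 G2 H2 : jet2 f1 G1 H1 -> jet2 f2 G2 H2 ->
  exists G, jet2 (oplus f1 f2) G (fun w =>
    lproj_mx *m H1 (lsubmx w) *m lproj_mx^T +
    rproj_mx *m H2 (rsubmx w) *m rproj_mx^T).
Proof.
move=> J1 J2.
have lE (w : 'rV[R]_(q + q)) : w *m lproj_mx + 0 = lsubmx w.
  by rewrite -[w in LHS]hsubmxK mul_row_col mulmx1 mulmx0 !addr0.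
have rE (w : 'rV[R]_(q + q)) : w *m rproj_mx + 0 = rsubmx w.
  by rewrite -[w in LHS]hsubmxK mul_row_col mulmx1 mulmx0 add0r addr0.
have := jet2D (jet2_affine lproj_mx 0 J1) (jet2_affine rproj_mx 0 J2).
rewrite (_ : (fun x => f1 _ + _) = oplus f1 f2); last first.
  by apply/funext => w; rewrite lE rE.
rewrite (_ : (fun x => lproj_mx *m _ *m _ + _) = fun w =>
    lproj_mx *m H1 (lsubmx w) *m lproj_mx^T +
    rproj_mx *m H2 (rsubmx w) *m rproj_mx^T); last first.
  by apply/funext => w; rewrite lE rE.
by move=> J; eexists; exact: J.
Qed.

Lemma act_oplus f1 f2 : C2 f1 -> C2 f2 ->
  C2 (oplus f1 f2) /\
  act (coupled_diffusion_op S) (oplus f1 f2) =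
    oplus (act (diffusion_op S) f1) (act (diffusion_op S) f2).
Proof.
move=> /C2_jet2 J1 /C2_jet2 J2; have [G J] := oplus_jet2 J1 J2.
split; first exact: jet2_C2 J.
apply/funext => w; rewrite (act_jet2 _ _ J) coupled_matrix_gram mulmxDr mxtraceD.
rewrite !mxtrace_gram_conj !tr_col_mx !mul_row_col.
by rewrite trmx1 trmx0 !mul1mx !mul0mx addr0 add0r mulrDr.
Qed.

Lemma dshift_jet2 (alpha : R) (z z' : 'rV[R]_q) : exists G,
  jet2 (fun w => alpha / 2 * dshift z z' w ^+ 2) G
    (fun _ => alpha *: (diff_mx *m 1%:M *m diff_mx^T)).
Proof.
have := jet2Z (alpha / 2) (jet2_affine diff_mx (z' - z) (@jet2_sqr R q)).
rewrite (_ : (fun x => alpha / 2 * _) = fun w => alpha / 2 * dshift z z' w ^+ 2);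
  last first.
  apply/funext => w; rewrite -enorm_row_sqr /dshift /Defs.edist; congr (_ * enorm _ ^+ 2).
  rewrite -[w in LHS]hsubmxK mul_row_col mulmx1 mulmxN mulmx1.
  by rewrite opprB addrACA [RHS]addrACA [- z - _]addrC.
rewrite (_ : (fun x => _ *: (diff_mx *m 2%:M *m _)) =
    fun=> alpha *: (diff_mx *m 1%:M *m diff_mx^T)); last first.
  apply/funext => w; rewrite -[2%:M]scalemx1 -scalemxAr -scalemxAl scalerA.
  by rewrite divfK// pnatr_eq0.
by move=> J; eexists; exact: J.
Qed.

(** The difference of the two components has noise coefficient S(x) - S(x');
    there is no first-order term, so the value is exact. *)
Lemma act_dshift (alpha : R) (z z' x x' : 'rV[R]_q) :
  act (coupled_diffusion_op S) (fun w => alpha / 2 * dshift z z' w ^+ 2)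
    (row_mx x x') = alpha / 2 * enorm (S x - S x') ^+ 2.
Proof.
have [G J] := dshift_jet2 alpha z z'.
rewrite (act_jet2 _ _ J) row_mxKl row_mxKr coupled_matrix_gram -scalemxAr.
rewrite mxtraceZ mxtrace_gram_conj mulmx1 tr_col_mx mul_row_col.
rewrite linearN/= trmx1 mul1mx mulNmx mul1mx mxtrace_mul_tr.
by rewrite mulrA [2^-1 * _]mulrC.
Qed.

(** Convexity of the square, a cheap substitute for the triangle inequality. The
    constant 3 is harmless, since the modulus may depend on the compact set. *)
Lemma edist_sqr_le3 (x y y' x' : 'rV[R]_q) :
  Defs.edist x x' ^+ 2 <= 3 * (Defs.edist x y + Defs.edist y y' + Defs.edist y' x') ^+ 2.
Proof.
apply: (@le_trans _ _ (3 * (Defs.edist x y ^+ 2 + Defs.edist y y' ^+ 2 + Defs.edist y' x' ^+ 2))).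
  rewrite /Defs.edist !enorm_row_sqr /dotv -!big_split mulr_sumr/=.
  apply: ler_sum => i _; rewrite !mxE.
  set u := x ord0 i; set v := y ord0 i; set v' := y' ord0 i; set u' := x' ord0 i.
  rewrite -subr_ge0 (_ : _ - _ = (u - v - (v - v')) ^+ 2 +
    (v - v' - (v' - u')) ^+ 2 + (u - v - (v' - u')) ^+ 2); last by ring.
  by rewrite !addr_ge0// sqr_ge0.
have := enorm_ge0 (x - y); have := enorm_ge0 (y - y'); have := enorm_ge0 (y' - x').
by rewrite /Defs.edist ler_pM2l//; nra.
Qed.

Lemma linear_modulus (c : R) : 0 <= c -> modulus_of_continuity (fun r => c * r).
Proof.
move=> c0; split=> [r r0||r e r0 e0]; rewrite ?mulr0//; first exact: mulr_ge0.
have cr : (fun s => c * s) @ r --> c * r by apply: cvgMr; exact: cvg_id.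
have : \forall s \near r, c * s < c * r + e.
  by move/cvgr_lt : cr; apply; rewrite ltrDl.
by apply: filterS => s.
Qed.

Lemma coupled_diffusion_controlled_growth : locally_lipschitz S ->
  controlled_growth_coupling (diffusion_op S) (coupled_diffusion_op S).
Proof.
move=> Slip; split.
- exact: second_order_op_linear.
- apply: second_order_op_max => w.
  by exists q, (col_mx (S (lsubmx w)) (S (rsubmx w))); exact: coupled_matrix_gram.
- exact: act_oplus.
- by move=> alpha z z' _; have [G J] := dshift_jet2 alpha z z'; exact: jet2_C2 J.
- move=> K /Slip[L SL]; exists (fun r => 3 * L ^+ 2 / 2 * r).
    by apply: linear_modulus; rewrite divr_ge0// mulr_ge0// sqr_ge0.
  move=> alpha x x' y y' alpha1 Kx Kx' Ky Ky'; cbv zeta; rewrite act_dshift.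
  set r := Defs.edist x y + _ + _.
  have r0 : 0 <= r by rewrite !addr_ge0// enorm_ge0.
  have S2 : enorm (S x - S x') ^+ 2 <= L ^+ 2 * Defs.edist x x' ^+ 2.
    have SLx := SL _ _ Kx Kx'.
    rewrite -exprMn ler_sqr ?nnegrE ?enorm_ge0//.
    exact: le_trans (enorm_ge0 _) SLx.
  have {}S2 : enorm (S x - S x') ^+ 2 <= L ^+ 2 * (3 * r ^+ 2).
    apply: le_trans S2 _; rewrite ler_wpM2l ?sqr_ge0//; exact: edist_sqr_le3.
  apply: (@le_trans _ _ (alpha / 2 * (L ^+ 2 * (3 * r ^+ 2)))).
    by rewrite ler_wpM2l//; lra.
  rewrite [leRHS]mulrDr [leLHS](_ : _ = 3 * L ^+ 2 / 2 * (alpha * r ^+ 2)).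
    by rewrite lerDl mulr_ge0// divr_ge0// mulr_ge0// sqr_ge0.
  by ring.
Qed.

End coupling.

(** * Profiles of radial functions *)

(** The profiles k are composed with |y|^2, so only points s >= 0 matter, but the
    derivatives at them are two-sided, also at s = 0: that is what the chain
    rule needs at y = 0. *)
Definition C2_nonneg (R : realType) (k k1 k2 : R -> R) : Prop :=
  forall s : R, 0 <= s ->
    [/\ is_derive s 1 k (k1 s), is_derive s 1 k1 (k2 s) & continuous_at s k2].

Section C2_nonneg_theory.
Variable R : realType.
Implicit Types k l : R -> R.

Lemma C2_nonneg_cst (c : R) : C2_nonneg (fun _ : R => c) (fun _ => 0) (fun _ => 0).
Proof.
by move=> s _; split; [exact: is_derive_cst|exact: is_derive_cst|exact: cst_continuous].
Qed.

Lemma C2_nonneg_id : C2_nonneg (fun s : R => s) (fun _ => 1) (fun _ => 0).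
Proof.
by move=> s _; split; [exact: is_derive_id|exact: is_derive_cst|exact: cst_continuous].
Qed.

Lemma C2_nonnegD k k1 k2 l l1 l2 : C2_nonneg k k1 k2 -> C2_nonneg l l1 l2 ->
  C2_nonneg (fun s => k s + l s) (fun s => k1 s + l1 s) (fun s => k2 s + l2 s).
Proof.
move=> kC lC s s0; have [kd kd1 kc] := kC s s0; have [ld ld1 lc] := lC s s0.
by split; [exact: is_derive_add|exact: is_derive_add|exact: continuousD].
Qed.

Lemma C2_nonnegM k k1 k2 l l1 l2 : C2_nonneg k k1 k2 -> C2_nonneg l l1 l2 ->
  C2_nonneg (fun s => k s * l s) (fun s => k s * l1 s + l s * k1 s)
    (fun s => (k s * l2 s + l1 s * k1 s) + (l s * k2 s + k1 s * l1 s)).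
Proof.
move=> kC lC s s0; have [kd kd1 kc] := kC s s0; have [ld ld1 lc] := lC s s0.
have [kdc kd1c] := (is_derive_continuous1 kd, is_derive_continuous1 kd1).
have [ldc ld1c] := (is_derive_continuous1 ld, is_derive_continuous1 ld1).
split; first exact: is_derive_mul.
  by apply: is_derive_add; exact: is_derive_mul.
apply: (@continuousD _ _ _ (fun s => k s * l2 s + l1 s * k1 s)
  (fun s => l s * k2 s + k1 s * l1 s)).
- by apply: (@continuousD _ _ _ (fun s => k s * l2 s) (fun s => l1 s * k1 s));
    exact: continuousM.
- by apply: (@continuousD _ _ _ (fun s => l s * k2 s) (fun s => k1 s * l1 s));
    exact: continuousM.
Qed.

Lemma is_derive_affine (a b s : R) : is_derive s 1 (fun t => a + b * t) b.
Proof.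
have b1 : is_derive s (1 : R) (fun t : R => b * t) b.
  have := is_derive_cmul b (is_derive_id s (1 : R)).
  by rewrite mulr1.
have := is_derive_add (is_derive_cst a s (1 : R)) b1.
by rewrite add0r.
Qed.

Lemma C2_nonneg_ln : C2_nonneg (fun s : R => ln (1 + 2^-1 * s))
  (fun s => (2 + 1 * s)^-1) (fun s => - (2 + 1 * s) ^- 2).
Proof.
move=> s s0; have s2 : 0 < 2 + 1 * s by rewrite mul1r ltr_wpDr.
have d2 := is_derive_affine 2 1 s.
split.
- have -> : (2 + 1 * s)^-1 = (1 + 2^-1 * s)^-1 * 2^-1.
    by rewrite -invfM; congr (_^-1); lra.
  apply: (@is_derive1_comp R (@ln R) (fun s => 1 + 2^-1 * s)).
    by apply: is_derive1_ln; rewrite ltr_wpDr// mulr_ge0.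
  exact: is_derive_affine.
- apply: is_derive_eq; first by apply: is_deriveV; rewrite gt_eqF.
  by rewrite [_ *: _]mulr1.
- have c2 : continuous_at s (fun t => 2 + 1 * t) by exact: is_derive_continuous1 d2.
  apply: cvgN; apply: cvgV; first by rewrite expf_neq0// gt_eqF.
  exact: (cvgM c2 c2).
Qed.

End C2_nonneg_theory.

Section radial_profile.
Variable R : realType.
Implicit Types (G dG : R -> R) (c r s : R).

(** Derivatives of the cutoff vanish where it is constant, by uniqueness of the
    derivative. *)
Lemma derive_locally_cst G (d c r1 r : R) :
  (forall t, 0 <= t < r1 -> G t = c) -> 0 < r < r1 ->
  is_derive r 1 G d -> d = 0.
Proof.
move=> Gc /andP[r0 rr1] Gd.
suff Gd0 : is_derive r 1 G 0.
  by rewrite -(@derive_val _ _ _ _ _ _ _ Gd) (@derive_val _ _ _ _ _ _ _ Gd0).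
apply: (near_eq_is_derive (f := fun=> c)).
near=> t; rewrite Gc//; apply/andP; split.
  by apply/ltW; near: t; exact: lt_nbhsr.
by near: t; exact: lt_nbhsl.
Unshelve. all: by end_near. Qed.

(** The square root is continuous on the whole line and vanishes on (-oo, 0]. *)
Lemma near_sqrt_lt (r1 s : R) : 0 < r1 -> s <= 0 ->
  \forall t \near s, 0 <= Num.sqrt t < r1.
Proof.
move=> r10 s0; have : Num.sqrt t @[t --> s] --> Num.sqrt s by exact: sqrt_continuous.
rewrite ler0_sqrtr// => /cvgr_lt/(_ r1 r10).
by apply: filterS => t ->; rewrite sqrtr_ge0.
Qed.

(** A single formula on both sides of 0: for s <= 0 the square root is 0, its
    inverse is 0 by convention, and so is the derivative of the locally constant
    function s |-> G(sqrt s). *)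
Lemma is_derive_sqrt_comp G dG (c r1 s : R) : 0 < r1 ->
  (forall r, 0 <= r < r1 -> G r = c) ->
  (forall r : R, 0 < r -> is_derive r 1 G (dG r)) ->
  is_derive s 1 (fun t => G (Num.sqrt t)) (dG (Num.sqrt s) / (2 * Num.sqrt s)).
Proof.
move=> r10 Gc Gd; have [s0|s0] := ltP 0 s.
  apply: (@is_derive1_comp _ G Num.sqrt); first by apply: Gd; rewrite sqrtr_gt0.
  exact: is_derive1_sqrt.
rewrite ler0_sqrtr// mulr0 invr0 mulr0.
apply: (near_eq_is_derive (f := fun=> c)).
by apply: filterS (near_sqrt_lt r10 s0) => t /Gc.
Qed.

(** The derivative of s |-> G(sqrt s) is s |-> Q(sqrt s) with
    Q(r) = G1(r) / (2 r), and Q is again constant (equal to 0) on [0, r1), so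
    that [is_derive_sqrt_comp] applies a second time. *)
Lemma C2_nonneg_sqrt_comp G G1 G2 (c r1 : R) : 0 < r1 ->
  (forall r, 0 <= r < r1 -> G r = c) ->
  (forall r : R, 0 < r -> [/\ is_derive r 1 G (G1 r), is_derive r 1 G1 (G2 r) &
    continuous_at r G2]) ->
  exists k1 k2, C2_nonneg (fun s => G (Num.sqrt s)) k1 k2.
Proof.
move=> r10 Gc GC.
have Gd (r : R) : 0 < r -> is_derive r 1 G (G1 r) by case/GC.
have inv_derive (r : R) : 0 < r ->
    is_derive r 1 (fun t => (0 + 2 * t)^-1) (- (0 + 2 * r) ^- 2 *: 2).
  move=> r0; apply: is_deriveV; first by rewrite add0r mulf_neq0// gt_eqF.
  exact: is_derive_affine.
pose Q r := G1 r * (0 + 2 * r)^-1.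
pose dQ r := G1 r * (- (0 + 2 * r) ^- 2 *: 2) + (0 + 2 * r)^-1 * G2 r.
have Qd (r : R) : 0 < r -> is_derive r 1 Q (dQ r).
  by move=> r0; have [_ G1d _] := GC r r0; apply: is_derive_mul => //; exact: inv_derive.
have Q0 r : 0 <= r < r1 -> Q r = 0.
  rewrite le_eqVlt => /andP[/orP[/eqP<- _|r0 rr1]].
    by rewrite /Q mulr0 addr0 invr0 mulr0.
  rewrite /Q (_ : G1 r = 0) ?mul0r//.
  by apply: (derive_locally_cst Gc _ (Gd r r0)); rewrite r0.
exists (fun s => Q (Num.sqrt s)), (fun s => dQ (Num.sqrt s) / (2 * Num.sqrt s)).
move=> s s0; split.
- by have := is_derive_sqrt_comp s r10 Gc Gd; rewrite /Q add0r.
- exact: is_derive_sqrt_comp r10 Q0 Qd.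
- have [{}s0|{}s0] := ltP 0 s; last first.
    apply: (near_cst_continuous 0).
    apply: filterS (near_sqrt_lt r10 s0) => t; rewrite le_eqVlt.
    move=> /andP[/orP[/eqP<- _|t0 tr1]]; first by rewrite mulr0 invr0 mulr0.
    by rewrite (derive_locally_cst Q0 _ (Qd _ t0)) ?mul0r// t0.
  have r0 : 0 < Num.sqrt s by rewrite sqrtr_gt0.
  apply: (continuous_at_comp (g := fun r => dQ r / (2 * r))).
    exact: sqrt_continuous.
  have [_ /is_derive_continuous1 G1c G2c] := GC _ r0.
  have ic := is_derive_continuous1 (inv_derive _ r0).
  have dQc : continuous_at (Num.sqrt s) dQ.
    have ic2 : continuous_at (Num.sqrt s) (fun r => - (0 + 2 * r) ^- 2 * 2).
      apply: (@continuousM _ _ (fun r : R => - (0 + 2 * r) ^- 2) (fun=> 2));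
        last exact: cst_continuous.
      apply: continuousN.
      have -> : (fun r : R => (0 + 2 * r) ^- 2) =
        (fun r => (0 + 2 * r)^-1 * (0 + 2 * r)^-1).
        by apply/funext => r; rewrite -expr2 exprVn.
      exact: continuousM.
    exact: (continuousD (continuousM G1c ic2) (continuousM ic G2c)).
  have -> : (fun r => dQ r / (2 * r)) = fun r => dQ r * (0 + 2 * r)^-1.
    by apply/funext => r; rewrite add0r.
  exact: continuousM.
Qed.

Lemma cutoff_C2_nonneg (r0 r1 r2 : R) (l : R -> R) : cutoff r0 r1 r2 l ->
  exists k1 k2, C2_nonneg (fun s => l (Num.sqrt s)) k1 k2.
Proof.
move=> [/andP[r00 r01] _ [g [gd lg]] _ [l1 _]].
apply: (@C2_nonneg_sqrt_comp l (derive1n 1 g) (derive1n 2 g) 1 r1); first exact: lt_trans r01.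
  exact: l1.
have gD n (r : R) : is_derive r 1 (derive1n n g) (derive1n n.+1 g r).
  by rewrite derive1nS derive1E; apply: derivableP; exact: gd.
move=> r r_gt0; split.
- apply: (near_eq_is_derive (f := g)); last exact: (gD 0 r).
  near=> t; rewrite lg//; apply/ltW; near: t; exact: lt_nbhsr.
- exact: (gD 1 r).
- exact: is_derive_continuous1 (gD 2 r).
Unshelve. all: by end_near. Qed.

End radial_profile.

(** * Joint continuity and compatibility *)

Lemma entry_le_enorm (R : realType) m n (X : 'M[R]_(m, n)) i j :
  `|X i j| <= enorm X.
Proof.
rewrite -sqrtr_sqr ler_wsqrtr// (bigD1 i)//= (bigD1 j)//= -addrA lerDl addr_ge0//.
  by apply: sumr_ge0 => k _; exact: sqr_ge0.
by do 2!apply: sumr_ge0 => ? _; exact: sqr_ge0.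
Qed.

(** The Lipschitz bound is used on a compact cube around the point. *)
Lemma locally_lipschitz_continuous (R : realType) q (S : 'rV[R]_q -> 'M[R]_q) :
  locally_lipschitz S -> continuous S.
Proof.
move=> Slip x.
pose K := [set v : 'rV[R]_q | forall i, `[x ord0 i - 1, x ord0 i + 1]%classic (v ord0 i)].
have [L SL] : exists L : R, forall y z, K y -> K z ->
    enorm (S y - S z) <= L * Defs.edist y z.
  apply: Slip; apply: (@rV_compact R q (fun i => `[x ord0 i - 1, x ord0 i + 1]%classic)).
  by move=> i; exact: segment_compact.
have Kx : K x by move=> i; rewrite /= in_itv/=; lra.
have nearK : \forall y \near x, K y.
  apply/nbhs_ballP; exists 1 => //= y [_ xy] i; have := xy ord0 i.
  by rewrite -ball_normE /= ltr_norml in_itv/=; lra.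
have dc : continuous_at x (fun y => L * Num.sqrt (dotv (y - x) (y - x)) : R).
  apply: continuous_cmul.
  apply: (continuous_at_comp (g := @Num.sqrt R)); last exact: sqrt_continuous.
  have yx : continuous_at x (fun y => y - x).
    by apply: continuousB; [exact: cvg_id|exact: cst_continuous].
  exact: continuous_dotv.
apply: continuous_entries => i j; apply/continuous_atP => e e0.
move/continuous_atP/(_ e e0): dc; rewrite subrr.
rewrite (_ : dotv 0 0 = 0 :> R); last first.
  by rewrite /dotv big1// => k _; rewrite mxE mul0r.
rewrite sqrtr0 mulr0; apply: filterS2 nearK => y Ky.
rewrite sub0r normrN => dye.
have := SL y x Ky Kx; rewrite {1}/Defs.edist [in leRHS]enorm_row => Syx.
apply: le_lt_trans dye; rewrite distrC.
have := entry_le_enorm (S y - S x) i j; rewrite !mxE => /le_trans; apply.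
by apply: le_trans Syx _; exact: ler_norm.
Qed.

Definition radial_hessian (R : realType) n (k1 k2 : R -> R) (y : 'rV[R]_n) :
    'M[R]_n :=
  k2 (dotv y y) *: ((2 *: y)^T *m (2 *: y)) + k1 (dotv y y) *: 2%:M.

Lemma jet2_radial (R : realType) n (k k1 k2 : R -> R) : C2_nonneg k k1 k2 ->
  jet2 (fun y : 'rV[R]_n => k (dotv y y)) (fun y => k1 (dotv y y) *: (2 *: y))
    (radial_hessian k1 k2).
Proof.
by move=> kC; apply: (jet2_comp (@jet2_sqr R n)) => x; apply: kC; exact: dotv_ge0.
Qed.

Definition radial_linear_hessian (R : realType) n (h h1 h2 : R -> R)
    (p y : 'rV[R]_n) : 'M[R]_n :=
  (h1 (dotv y y) *: (2 *: y))^T *m p + p^T *m (h1 (dotv y y) *: (2 *: y)) +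
  dotv p y *: radial_hessian h1 h2 y.

Lemma jet2_radial_linear (R : realType) n (h h1 h2 : R -> R) (p : 'rV[R]_n) :
  C2_nonneg h h1 h2 -> exists G,
  jet2 (fun y : 'rV[R]_n => h (dotv y y) * dotv p y) G
    (radial_linear_hessian h h1 h2 p).
Proof.
move=> hC; have := jet2M (jet2_radial n hC) (jet2_dotv p).
rewrite (_ : (fun x => _ + _ + _ + _) = radial_linear_hessian h h1 h2 p).
  by move=> J; eexists; exact: J.
by apply/funext => y; rewrite scaler0 add0r.
Qed.

Section compatibility.
Variables (R : realType) (q : nat).

Lemma continuous_radial (T : topologicalType) (F : T -> 'rV[R]_q) (t : T)
    (g : R -> R) : continuous_at t F -> (forall s : R, 0 <= s -> continuous_at s g) ->
  continuous_at t (fun u => g (dotv (F u) (F u))).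
Proof.
move=> Ft gc; apply: (continuous_at_comp (continuous_dotv Ft Ft)).
by apply: gc; exact: dotv_ge0.
Qed.

Lemma continuous_radial_hessian (l l1 l2 : R -> R) (T : topologicalType)
    (F : T -> 'rV[R]_q) (t : T) : C2_nonneg l l1 l2 -> continuous_at t F ->
  continuous_at t (fun u => radial_hessian l1 l2 (F u)).
Proof.
move=> lC Ft.
have F2 : continuous_at t (fun u => 2 *: F u).
  by apply: continuous_scalemx => //; exact: cst_continuous.
apply: continuous_addmx; apply: continuous_scalemx.
- by apply: continuous_radial => // s /lC[].
- by apply: continuous_mulmx => //; exact: continuous_trmx.
- by apply: continuous_radial => // s /lC[_ /is_derive_continuous1].
- exact: cst_continuous.
Qed.

Lemma continuous_radial_linear_hessian (h h1 h2 : R -> R)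
    (T : topologicalType) (P F : T -> 'rV[R]_q) (t : T) : C2_nonneg h h1 h2 ->
  continuous_at t P -> continuous_at t F ->
  continuous_at t (fun u => radial_linear_hessian h h1 h2 (P u) (F u)).
Proof.
move=> hC Pt Ft.
have F2 : continuous_at t (fun u => h1 (dotv (F u) (F u)) *: (2 *: F u)).
  apply: continuous_scalemx.
    by apply: continuous_radial => // s /hC[_ /is_derive_continuous1].
  by apply: continuous_scalemx => //; exact: cst_continuous.
apply: continuous_addmx; first apply: continuous_addmx.
- by apply: continuous_mulmx => //; exact: continuous_trmx.
- by apply: continuous_mulmx => //; exact: continuous_trmx.
- apply: continuous_scalemx; first exact: continuous_dotv.
  exact: continuous_radial_hessian hC _.
Qed.

Lemma continuous_half_mxtrace (a : 'rV[R]_q -> 'M[R]_q) (T : topologicalType)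
    (X : T -> 'rV[R]_q) (F : T -> 'M[R]_q) (t : T) :
  continuous a -> continuous_at t X -> continuous_at t F ->
  continuous_at t (fun u => 2^-1 * \tr (a (X u) *m F u) : R).
Proof.
move=> ac Xt Ft.
have trc : continuous_at t (fun u => \tr (a (X u) *m F u)).
  apply: continuous_mxtrace; apply: continuous_mulmx => //.
  by apply: (continuous_at_comp Xt); exact: ac.
exact: continuous_cmul.
Qed.

(** The Hessian of a shifted penalization is the explicit Hessian at the shifted
    points x - z - z0 and x - z - z1, a composition of continuous maps on the
    whole parameter space. *)
Lemma compatible_radial (a : 'rV[R]_q -> 'M[R]_q)
    (v v1 v2 h h1 h2 k k1 k2 : R -> R) (V : 'rV[R]_q -> R)
    (zeta : 'rV[R]_q -> 'rV[R]_q -> 'rV[R]_q -> R)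
    (xi : 'rV[R]_q -> 'rV[R]_q -> R) :
  continuous a -> C2_nonneg v v1 v2 -> C2_nonneg h h1 h2 -> C2_nonneg k k1 k2 ->
  (forall x, V x = v (dotv x x)) ->
  (forall z p x, zeta z p x = h (dotv (x - z) (x - z)) * dotv p (x - z)) ->
  (forall z x, xi z x = k (dotv (x - z) (x - z))) ->
  compatible (second_order_op a) V zeta xi.
Proof.
move=> a_continuous vC hC kC VE zetaE xiE.
have JV z : jet2 (V \o shift_by z) (fun x => v1 (dotv (x - z) (x - z)) *: (2 *: (x - z)))
    (fun x => radial_hessian v1 v2 (x - z)).
  rewrite (_ : V \o _ = fun x => v (dotv (x - z) (x - z))).
    exact: jet2_shift (jet2_radial q vC).
  by apply/funext => x; rewrite /= VE.
have JX z z0 p z1 : exists G, jet2 (Xi zeta xi z0 p z1 \o shift_by z) G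
    (fun x => radial_hessian k1 k2 (x - z - z0) +
              radial_linear_hessian h h1 h2 p (x - z - z0) +
              radial_hessian k1 k2 (x - z - z1)).
  have [G Jp] := jet2_radial_linear p hC; have Jk := jet2_radial q kC.
  have := jet2D (jet2D (jet2_shift z (jet2_shift z0 Jk))
    (jet2_shift z (jet2_shift z0 Jp))) (jet2_shift z (jet2_shift z1 Jk)).
  rewrite (_ : (fun x => k _ + _ + _) = Xi zeta xi z0 p z1 \o shift_by z).
    by move=> J; eexists; exact: J.
  by apply/funext => x; rewrite /Xi/= !xiE zetaE.
have fstc (T U : topologicalType) : continuous (@fst T U) by move=> ?; exact: cvg_fst.
have sndc (T U : topologicalType) : continuous (@snd T U) by move=> ?; exact: cvg_snd.
have subc (T : topologicalType) (F G : T -> 'rV[R]_q) t : continuous_at t F ->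
    continuous_at t G -> continuous_at t (fun u => F u - G u).
  exact: continuousB.
split.
- by move=> z _; exact: jet2_C2 (JV z).
- by move=> z z0 p z1 _; have [G J] := JX z z0 p z1; exact: jet2_C2 J.
- apply: continuous_subspaceT => t.
  rewrite (_ : (fun _ => _) = fun t : 'rV[R]_q * 'rV[R]_q * 'rV[R]_q * 'rV[R]_q * 'rV[R]_q =>
      2^-1 * \tr (a t.1.1.1.1 *m
        (radial_hessian k1 k2 (t.1.1.1.1 - t.2 - t.1.1.1.2) +
         radial_linear_hessian h h1 h2 t.1.1.2 (t.1.1.1.1 - t.2 - t.1.1.1.2) +
         radial_hessian k1 k2 (t.1.1.1.1 - t.2 - t.1.2)))); last first.
    apply/funext => -[[[[x z0] p] z1] z] /=.
    by have [G J] := JX z z0 p z1; rewrite (jet2_hessian J).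
  have c1 := fstc _ _ t; have c2 := continuous_at_comp c1 (fstc _ _ t.1).
  have c3 := continuous_at_comp c2 (fstc _ _ t.1.1).
  have cx := continuous_at_comp c3 (fstc _ _ t.1.1.1).
  have cz0 := continuous_at_comp c3 (sndc _ _ t.1.1.1).
  have cp := continuous_at_comp c2 (sndc _ _ t.1.1).
  have cz1 := continuous_at_comp c1 (sndc _ _ t.1).
  have cz := sndc _ _ t.
  apply: continuous_half_mxtrace => //; apply: continuous_addmx; first apply: continuous_addmx.
  + apply: (continuous_radial_hessian kC).
    exact: (subc _ _ _ _ (subc _ _ _ _ cx cz) cz0).
  + apply: (continuous_radial_linear_hessian hC) => //.
    exact: (subc _ _ _ _ (subc _ _ _ _ cx cz) cz0).
  + apply: (continuous_radial_hessian kC).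
    exact: (subc _ _ _ _ (subc _ _ _ _ cx cz) cz1).
- apply: continuous_subspaceT => t.
  rewrite (_ : (fun _ => _) = fun t : 'rV[R]_q * 'rV[R]_q =>
      2^-1 * \tr (a t.1 *m radial_hessian v1 v2 (t.1 - t.2))); last first.
    by apply/funext => -[x z] /=; rewrite (jet2_hessian (JV z)).
  apply: continuous_half_mxtrace => //; first exact: fstc.
  by apply: (continuous_radial_hessian vC); apply: subc; [exact: fstc|exact: sndc].
Qed.

End compatibility.

(** * The diffusion operator *)

Lemma edistE (R : realType) q (x z : 'rV[R]_q) :
  Defs.edist x z = Num.sqrt (dotv (x - z) (x - z)).
Proof. exact: enorm_row. Qed.

Lemma edist_sqr (R : realType) q (x z : 'rV[R]_q) :
  Defs.edist x z ^+ 2 = dotv (x - z) (x - z).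
Proof. exact: enorm_row_sqr. Qed.

Lemma compatible_quadratic (R : realType) q (a : 'rV[R]_q -> 'M[R]_q) :
  continuous a ->
  compatible (second_order_op a) (@logV R q) (@zeta1 R q) (@xi1 R q).
Proof.
move=> ac; apply: (compatible_radial ac (@C2_nonneg_ln R) (C2_nonneg_cst 1)
  (C2_nonnegM (C2_nonneg_cst 2^-1) (@C2_nonneg_id R))).
- by move=> x; rewrite /logV enorm_row_sqr.
- by move=> z p x; rewrite mul1r.
- by move=> z x; rewrite /xi1 edist_sqr.
Qed.

Lemma compatible_cutoff (R : realType) q (a : 'rV[R]_q -> 'M[R]_q)
    (r0 r1 r2 : R) (l : R -> R) : continuous a -> cutoff r0 r1 r2 l ->
  compatible (second_order_op a) (@logV R q) (@zeta2 R q l) (@xi2 R q r2 l).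
Proof.
move=> ac /cutoff_C2_nonneg[h1 [h2 hC]].
have kC := C2_nonnegD
  (C2_nonnegM (C2_nonnegD (C2_nonneg_cst 1) (C2_nonnegM (C2_nonneg_cst (-1)) hC))
    (C2_nonneg_cst ((r2 + 1) ^+ 2)))
  (C2_nonnegM hC (C2_nonnegM (C2_nonneg_cst 2^-1) (@C2_nonneg_id R))).
apply: (compatible_radial ac (@C2_nonneg_ln R) hC kC).
- by move=> x; rewrite /logV enorm_row_sqr.
- by move=> z p x; rewrite /zeta2 edistE.
- by move=> z x; rewrite /xi2 edist_sqr edistE mulN1r.
Qed.

Lemma continuous_gram (R : realType) q (S : 'rV[R]_q -> 'M[R]_q) :
  continuous S -> continuous (fun x => S x *m (S x)^T).
Proof.
by move=> Sc x; apply: continuous_mulmx; [exact: Sc|apply: continuous_trmx; exact: Sc].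
Qed.

(** The rank-one part of the Hessian of log(1 + |x|^2 / 2) contributes a
    nonpositive term; what remains is |S(x)|^2 / (2 + |x|^2), and
    2 (2 + N^2) - (1 + N)^2 = (1 - N)^2 + 2 is nonnegative. *)
Lemma logV_lyapunov (R : realType) q (S : 'rV[R]_q -> 'M[R]_q) (c : R) x :
  enorm (S x) <= c / 2 * (1 + enorm x) ->
  act (diffusion_op S) (@logV R q) x <= c ^+ 2 / 2.
Proof.
move=> Sx.
have [G J] : exists G, jet2 (@logV R q) G (radial_hessian (fun s => (2 + 1 * s)^-1)
    (fun s => - (2 + 1 * s) ^- 2)).
  rewrite (_ : @logV R q = fun x => ln (1 + 2^-1 * dotv x x)).
    by eexists; exact: jet2_radial (@C2_nonneg_ln R).
  by apply/funext => y; rewrite /logV enorm_row_sqr.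
rewrite (act_jet2 _ _ J) /radial_hessian mul1r mulmxDr mxtraceD.
rewrite -!scalemxAr !mxtraceZ -scalemx1 -scalemxAr mulmx1 mxtraceZ mxtrace_mul_tr.
have xS : 0 <= \tr (S x *m (S x)^T *m ((2 *: x)^T *m (2 *: x))).
  rewrite mulmxA mxtrace_mulC !mulmxA -mulmxA -trmx_mul mxtrace_mul_tr.
  exact: sqr_ge0.
rewrite -scalemxAr -scalemxAr mxtraceZ in xS.
rewrite -enorm_row_sqr; have n0 := enorm_ge0 x; have m0 := enorm_ge0 (S x).
set N := enorm x in Sx n0 *; set M := enorm (S x) in Sx m0 *.
have d0 : 0 < 2 + N ^+ 2 by rewrite ltr_wpDr// sqr_ge0.
apply: (@le_trans _ _ (M ^+ 2 / (2 + N ^+ 2))).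
  rewrite [leRHS](_ : _ = 2^-1 * ((2 + N ^+ 2)^-1 * (2 * M ^+ 2))); last first.
    by rewrite [RHS]mulrCA mulKf ?pnatr_eq0// mulrC.
  rewrite ler_wpM2l// gerDr mulNr oppr_le0 mulr_ge0//.
  by rewrite invr_ge0 sqr_ge0.
rewrite ler_pdivrMr//.
apply: (@le_trans _ _ ((c / 2 * (1 + N)) ^+ 2)).
  by rewrite ler_sqr ?nnegrE// (le_trans m0).
(* The constant c^2 / 2 leaves exactly this sum of squares. *)
rewrite -subr_ge0 (_ : _ - _ = (c / 2) ^+ 2 * ((1 - N) ^+ 2 + 2)); last by field.
by rewrite mulr_ge0 ?addr_ge0 ?sqr_ge0.
Qed.

Theorem proposition4p5 (R : realType) (q : nat)
    (Sigma : 'rV[R]_q -> 'M[R]_q) (cSigma : R)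
    (Sigma_psd : forall x, psd (Sigma x))
    (Sigma_lip : locally_lipschitz Sigma)
    (cSigma_gt0 : 0 < cSigma)
    (Sigma_growth : forall x, enorm (Sigma x) <= cSigma / 2 * (1 + enorm x)) :
  let A := diffusion_op Sigma in
  [/\ compatible A (@logV R q) (@zeta1 R q) (@xi1 R q),
      forall (r0 r1 r2 : R) (l : R -> R), cutoff r0 r1 r2 l ->
        compatible A (@logV R q) (@zeta2 R q l) (@xi2 R q r2 l),
      linear_on_domain A,
      controlled_growth_coupling A (coupled_diffusion_op Sigma)
    & (ereal_sup (range (fun x => (act A (@logV R q) x)%:E)) < +oo)%E].
Proof.
have gram_c := continuous_gram (locally_lipschitz_continuous Sigma_lip).
split.
- exact: compatible_quadratic.
- by move=> r0 r1 r2 l; exact: compatible_cutoff.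
- exact: second_order_op_linear.
- exact: coupled_diffusion_controlled_growth.
- apply: (@le_lt_trans _ _ (cSigma ^+ 2 / 2)%:E); last exact: ltry.
  apply: ge_ereal_sup => _ [x _ <-]; rewrite lee_fin.
  exact: logV_lyapunov.
Qed.
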